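(* Suppose that the latent pairs $(X_1,\mathbb Q_1),\ldots,(X_{n+1},\mathbb Q_{n+1})$ are exchangeable and that, conditional on these pairs, the outcomes $Y_1,\ldots,Y_{n+1}$ are independent with $Y_i\sim\mathbb Q_i$. Let $\alpha\in(0,1)$, and let the aggregation rule $\nu$ be fixed independently of the calibration sample $\mathcal D_n=(X_i,Y_i)_{i=1}^n$ and of the future instance $(X_{n+1},\mathbb Q_{n+1},Y_{n+1})$. Let $$\widehat z_n(x)\in\operatorname*{arg\,min}_{z\in\mathcal Z(x)}\mathcal R_{\alpha,\nu,x}\bigl(c(z,\cdot)\bigr),\qquad \widehat V_n(x)=\mathcal R_{\alpha,\nu,x}\bigl(c(\widehat z_n(x),\cdot)\bigr).$$ Then $$\mathbb P\left\{\int_{\mathcal Y}c\bigl(\widehat z_n(X_{n+1}),y\bigr)\,\mathbb Q_{n+1}(\mathrm dy)\le\widehat V_n(X_{n+1})\right\}\ge1-\alpha .$$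
   Context: Setting. $\mathcal X,\mathcal Y$ are standard Borel spaces; $\mathcal P(\mathcal Y)$ is the set of probability measures on $\mathcal Y$. For each $i=1,\ldots,n+1$, $X_i$ is an $\mathcal X$-valued context, $\mathbb Q_i$ is an unobserved random element of $\mathcal P(\mathcal Y)$ with $\mathbb Q_i\mid X_i\sim\pi(\cdot\mid X_i)$ for an unknown kernel $\pi$, and $Y_i$ is a $\mathcal Y$-valued outcome with $Y_i\mid(X_i,\mathbb Q_i)\sim\mathbb Q_i$. $\mathcal Z(x)$ is the feasible decision set at $x$, and $c(z,y)$ is a real-valued measurable cost for which the integrals $\int c(z,y)\,\mathbb Q(\mathrm dy)$ below are well defined (e.g. $c(z,\cdot)$ bounded). The minimizer $\widehat z_n$ is assumed to exist and be chosen so that $\widehat z_n(X_{n+1})$ and $\widehat V_n(X_{n+1})$ are measurable; both depend on $\mathcal D_n$. Split conformal sets. $s:\mathcal X\times\mathcal Y\to\mathbb R$ is a measurable nonconformity score built from a predictor trained on data independent of the calibration data and the next instance; it is treated as a fixed function. Put $S_i=s(X_i,Y_i)$. For $\gamma\in(0,1)$ let $k_\gamma=\lceil(n+1)(1-\gamma)\rceil$, let $\widehat q_{1-\gamma}$ be the $k_\gamma$-th smallest value among $S_1,\ldots,S_n$ (with $\widehat q_{1-\gamma}=+\infty$ if $k_\gamma=n+1$), and $\mathcal C_\gamma(x)=\{y\in\mathcal Y:s(x,y)\le\widehat q_{1-\gamma}\}$. Aggregation rule, ambiguity set, robust risk. $\Gamma\subset(0,\alpha)$; $\nu=\sum_{k=1}^Kw_k\delta_{\gamma_k}$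 with $K\ge1$, $\gamma_k\in\Gamma$, $w_k\ge0$, $\sum_kw_k=1$. $$\mathfrak U_\alpha^\nu(x)=\left\{\mathbb Q\in\mathcal P(\mathcal Y):\ \sum_{k=1}^K\frac{w_k}{\gamma_k}\bigl(1-\mathbb Q(\mathcal C_{\gamma_k}(x))\bigr)\le\frac1\alpha\right\},$$ assumed nonempty, and $$\mathcal R_{\alpha,\nu,x}(c(z,\cdot))=\sup_{\mathbb Q\in\mathfrak U_\alpha^\nu(x)}\int_{\mathcal Y}c(z,y)\,\mathbb Q(\mathrm dy).$$ *)

(* Defs.v *)
From mathcomp Require Import all_boot all_order all_algebra all_fingroup.
From mathcomp Require Import all_classical all_reals all_analysis measurable_realfun.

Set Implicit Arguments.
Unset Strict Implicit.
Unset Printing Implicit Defensive.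

Import Order.TTheory GRing.Theory Num.Theory.
Import numFieldNormedType.Exports.

Local Open Scope classical_set_scope.
Local Open Scope ring_scope.

(* [M] carries a complete metric (the Hausdorff condition makes its
   pseudometric separated) and is separable, i.e. it is a Polish space; [f]
   identifies the sigma-algebra of [T] with the Borel sets of [M]. *)
Definition standard_borel (R : realType) (d : measure_display)
    (T : measurableType d) : Prop :=
  exists (M : completePseudoMetricType R) (f : T -> M),
    [/\ hausdorff_space M, @second_countable M, bijective f &
        (measurable : set (set T)) =
          preimage_set_system [set: T] f <<s (open : set (set M)) >> ].

Definition exchangeable (R : realType) (d0 d : measure_display)
    (Omega : measurableType d0) (T : measurableType d)
    (P : probability Omega R) (m : nat) (W : 'I_m -> Omega -> T) : Prop :=
  forall (sigma : 'S_m) (A : set (m.-tuple T)), measurable A ->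
    P [set omega | A [tuple W (sigma i) omega | i < m]] =
    P [set omega | A [tuple W i omega | i < m]].

(* [g \o L] is a version of the conditional probability of [E] given the
   sigma-algebra generated by [L]. *)
Definition is_cond_prob (R : realType) (d0 d : measure_display)
    (Omega : measurableType d0) (T : measurableType d)
    (P : probability Omega R) (L : Omega -> T) (E : set Omega)
    (g : T -> \bar R) : Prop :=
  measurable_fun [set: T] g /\
  forall A : set T, measurable A ->
    P (L @^-1` A `&` E) = (\int[P]_(omega in L @^-1` A) g (L omega))%E.

(* [kappa] is the conditional distribution of [V] given [L]. *)
Definition has_cond_law (R : realType) (d0 d d' : measure_display)
    (Omega : measurableType d0) (T : measurableType d) (T' : measurableType d')
    (P : probability Omega R) (V : Omega -> T') (L : Omega -> T)
    (kappa : R.-pker T ~> T') : Prop :=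
  forall B : set T', measurable B ->
    is_cond_prob P L (V @^-1` B) (fun t => kappa t B).

Definition latent (R : realType) (d0 dX dY : measure_display)
    (Omega : measurableType d0) (TX : measurableType dX)
    (TY : measurableType dY) (m : nat) (X : 'I_m -> Omega -> TX)
    (Q : 'I_m -> Omega -> pprobability TY R) (i : 'I_m) (omega : Omega) :
    TX * pprobability TY R :=
  (X i omega, Q i omega).

(* Conditionally on all the latent pairs, the outcomes [Y i] are independent
   with respective laws [Q i]: the conditional probability of the event
   [Y i \in B i for all i] is the product of the [Q i (B i)]. *)
Definition outcomes_cond_indep (R : realType) (d0 dX dY : measure_display)
    (Omega : measurableType d0) (TX : measurableType dX)
    (TY : measurableType dY) (P : probability Omega R) (m : nat)
    (X : 'I_m -> Omega -> TX) (Q : 'I_m -> Omega -> pprobability TY R)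
    (Y : 'I_m -> Omega -> TY) : Prop :=
  forall B : 'I_m -> set TY, (forall i, measurable (B i)) ->
    is_cond_prob P (fun omega => [tuple latent X Q i omega | i < m])
      [set omega | forall i, B i (Y i omega)]
      (fun t => \big[*%E/1%E]_(i < m)
         ((tnth t i).2 : probability TY R) (B i)).

Definition calibration (d0 dX dY : measure_display)
    (Omega : measurableType d0) (TX : measurableType dX)
    (TY : measurableType dY) (n : nat) (X : 'I_n.+1 -> Omega -> TX)
    (Y : 'I_n.+1 -> Omega -> TY) (omega : Omega) : n.-tuple (TX * TY) :=
  [tuple (X (widen_ord (leqnSn n) i) omega, Y (widen_ord (leqnSn n) i) omega)
  | i < n].

Definition conformal_rank (R : realType) (n : nat) (gamma : R) : nat :=
  `|Num.ceil (n.+1%:R * (1 - gamma))|%N.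

(* The [k]-th smallest value is the entry of index [k - 1] in the sorted
   sequence of scores. *)
Definition conformal_quantile (R : realType) (n : nat) (S : n.-tuple R)
    (gamma : R) : \bar R :=
  let k := conformal_rank n gamma in
  if k == n.+1 then +oo%E else (nth 0 (sort <=%R S) k.-1)%:E.

Definition conformal_set (R : realType) (TX TY : Type) (n : nat)
    (s : TX -> TY -> R) (D : n.-tuple (TX * TY)) (gamma : R) (x : TX) :
    set TY :=
  [set y | ((s x y)%:E <=
            conformal_quantile [tuple of map (fun p => s p.1 p.2) D] gamma)%E].

(* The aggregation rule [\sum_k w_k \d_(gamma_k)] is given by its weights [w]
   and its atoms [gamma]. *)
Definition ambiguity_set (R : realType) (TX : Type) (dY : measure_display)
    (TY : measurableType dY) (n : nat) (s : TX -> TY -> R) (alpha : R)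
    (K : nat) (w gamma : 'I_K -> R) (D : n.-tuple (TX * TY)) (x : TX) :
    set (probability TY R) :=
  [set Q | (\sum_(k < K) (w k / gamma k)%:E *
              (1 - Q (conformal_set s D (gamma k) x)) <= (alpha^-1)%:E)%E].

Definition robust_risk (R : realType) (dY : measure_display)
    (TY : measurableType dY) (U : set (probability TY R)) (f : TY -> R) :
    \bar R :=
  ereal_sup [set (\int[Q]_y (f y)%:E)%E | Q in U].

Definition argmin_set (R : realType) (Z : Type) (A : set Z)
    (f : Z -> \bar R) : set Z :=
  [set z | A z /\ forall z', A z' -> (f z <= f z')%E].

(* The integral is not of the indeterminate form [+oo - +oo]. *)
Definition integral_defined (R : realType) (dY : measure_display)
    (TY : measurableType dY) (Q : probability TY R) (f : TY -> R) : Prop :=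
  (\int[Q]_y (EFin \o f)^\+ y +? - \int[Q]_y (EFin \o f)^\- y)%E.

(* Main.v *)
Require Import Defs.
From mathcomp Require Import all_boot all_order all_algebra all_fingroup.
From mathcomp Require Import all_classical all_reals all_analysis measurable_realfun.

Set Implicit Arguments.
Unset Strict Implicit.
Unset Printing Implicit Defensive.

Import Order.TTheory GRing.Theory Num.Theory.
Import numFieldNormedType.Exports.

Local Open Scope classical_set_scope.
Local Open Scope ring_scope.

(** Whenever the future conditional law [Qnew] belongs to the ambiguity set, its
expected cost is one of the values whose supremum is the robust risk, so the
guarantee holds on that event. It remains to show that [Qnew] belongs to the
ambiguity set with probability at least [1 - alpha].

Membership says that the random variable
[M = \sum_k w_k / gamma_k * (1 - Qnew (C_(gamma_k) (Xnew)))] is at most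
[1 / alpha]. By Markov's inequality ([markov_inv_level]) this fails with
probability at most [alpha] as soon as [M] has expectation at most 1, and for
this it is enough that each conformal set has expected miscoverage
[E (1 - Qnew (C_gamma (Xnew))) <= gamma] ([integral_miscoverage_le]).

The expected miscoverage is the probability that the future outcome falls
outside the conformal set: redrawing it from [Qnew] with everything else held
fixed does not change the law of the sample ([prob_sample_resample]). The pairs
[(X i, Y i)] inherit exchangeability from the latent pairs
([exchangeable_sample]), and the future outcome is missed exactly when at least
[k = conformal_rank n gamma] of the scores are strictly below its own
([conformal_setPn]). At most [n + 1 - k] of the [n + 1] indices can have this
property ([card_exceeds]), so by exchangeability each of them has it with
probability at most [(n + 1 - k) / (n + 1) <= gamma]
([exchangeable_prob_exceeds]).

Both facts about the law of the sample are identities between finite measures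
on tuples of pairs. They are checked on products of rectangles
([tuple_pair_measure_unique]), where the conditional independence of the
outcomes turns probabilities into integrals of functions of the latent pairs
([integral_outcomes_in]). *)

(** * Counting large ranks *)

Definition exceeds (disp : Order.disp_t) (T : porderType disp) (m k : nat)
    (v : 'I_m -> T) (j : 'I_m) : bool :=
  (k <= #|[set i | (v i < v j)%O]%SET|)%N.

(** Among the indices having [k] values strictly below them, take one with the
smallest value: the [k] indices below it cannot belong to the family. *)
Lemma card_exceeds (disp : Order.disp_t) (T : orderType disp) (m k : nat)
    (v : 'I_m -> T) :
  (#|[set j | exceeds k v j]%SET| <= m - k)%N.
Proof.
have [->|/set0Pn[j0]] := eqVneq [set j | exceeds k v j]%SET finset.set0.
  by rewrite cards0.
rewrite inE => j0k.
have [j jk jmin] := arg_minP v j0k.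
have sub : [set j | exceeds k v j]%SET \subset ~: [set i | (v i < v j)%O]%SET.
  by apply/fintype.subsetP => i; rewrite !inE -leNgt => /jmin.
apply: (leq_trans (subset_leq_card sub)).
have := cardsC [set i | (v i < v j)%O]%SET; rewrite card_ord => cE.
by rewrite -[X in (_ <= X - _)%N]cE -addnBAC// leq_addl.
Qed.

(** Reindexing the values by a permutation moves a fixed position over all the
indices, which is how exchangeability is used. *)
Lemma exceeds_perm (disp : Order.disp_t) (T : porderType disp) (m k : nat)
    (v : 'I_m -> T) (sigma : 'S_m) (j : 'I_m) :
  exceeds k (fun i => v (sigma i)) j = exceeds k v (sigma j).
Proof.
rewrite /exceeds; congr (_ <= _)%N.
rewrite -(card_preimset [set i | (v i < v (sigma j))%O]%SET (@perm_inj _ sigma)).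
by apply: eq_card => i; rewrite !inE.
Qed.

Lemma nth_sort_lt (disp : Order.disp_t) (T : orderType disp) (x0 a : T)
    (s : seq T) (k : nat) : (k < size s)%N ->
  (nth x0 (sort <=%O s) k < a)%O = (k < count (fun x => (x < a)%O) s)%N.
Proof.
move=> ks; have ss := sort_le_sorted s.
rewrite -(seq.permP (permEl (perm_sort <=%O s))).
have [kc|ck] := ltnP k (count (fun x => (x < a)%O) (sort <=%O s)).
  by apply: nth_count_lt.
apply/negbTE; rewrite -leNgt; apply: nth_count_ge => //.
by rewrite ck size_sort.
Qed.

(** * Conformal sets in terms of ranks *)

Section conformal_rank.
Context (R : realType) (n : nat) (gamma : R).
Hypothesis gamma01 : 0 < gamma < 1.

Lemma conformal_rank_ge : n.+1%:R * (1 - gamma) <= (conformal_rank n gamma)%:R.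
Proof.
have [g0 g1] := andP gamma01.
rewrite /conformal_rank natr_absz gtr0_norm ?ceil_ge//.
by rewrite ceil_gt0 mulr_gt0// subr_gt0.
Qed.

Lemma conformal_rank_gt0 : (0 < conformal_rank n gamma)%N.
Proof.
have [g0 g1] := andP gamma01.
rewrite -(ltr0n R) (lt_le_trans _ conformal_rank_ge)// mulr_gt0// subr_gt0//.
Qed.

Lemma conformal_rank_le : (conformal_rank n gamma <= n.+1)%N.
Proof.
have [g0 g1] := andP gamma01.
rewrite -lez_nat /conformal_rank gtz0_abs ?ceil_gt0 ?mulr_gt0 ?subr_gt0//.
rewrite ceil_le_int -[leRHS]mulr1 ler_wpM2l// gerBl ltW//.
Qed.

End conformal_rank.

(** The calibration quantile is replaced by a count over all [n + 1] scores. The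
score of the new point may be counted too, as it is not strictly below itself,
and this makes the condition symmetric in the sample. *)
Lemma conformal_setPn (R : realType) (TX TY : Type) (n : nat)
    (s : TX -> TY -> R) (t : n.+1.-tuple (TX * TY)) (D : n.-tuple (TX * TY))
    (gamma : R) (x : TX) (y : TY) :
  0 < gamma < 1 ->
  (forall i, tnth t (widen_ord (leqnSn n) i) = tnth D i) ->
  tnth t ord_max = (x, y) ->
  ~ conformal_set s D gamma x y <->
  exceeds (conformal_rank n gamma) (fun i => s (tnth t i).1 (tnth t i).2) ord_max.
Proof.
move=> g01 tD tmax.
have k0 := conformal_rank_gt0 n g01; have kn := conformal_rank_le n g01.
set k := conformal_rank n gamma in k0 kn *.
pose S := [tuple of map (fun p => s p.1 p.2) D].
have cE : #|[set i | s (tnth t i).1 (tnth t i).2 <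
     s (tnth t ord_max).1 (tnth t ord_max).2]%SET| = count (fun r => r < s x y) S.
  rewrite tmax/= -sum1_card big_mkcond/= big_ord_recr/= inE tmax/= ltxx addn0.
  rewrite -sum1_count big_map big_tuple [RHS]big_mkcond/=.
  by apply: eq_bigr => i _; rewrite inE tD.
rewrite /exceeds cE /conformal_set /conformal_quantile /= -/k.
have [->|kn1] := eqVneq k n.+1.
  (* rank n + 1: only n calibration scores can lie below the new one *)
  rewrite leey; split => // ck; exfalso.
  by have := count_size (fun r => r < s x y) S; rewrite size_tuple leqNgt ck.
have {kn1} kn' : (k <= n)%N by rewrite -ltnS ltn_neqAle kn1.
rewrite lee_fin -[X in (X <= count _ _)%N](prednK k0).
rewrite -(nth_sort_lt 0) ?size_tuple ?prednK//.
by rewrite ltNge; split => [/negP|/negP].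
Qed.

(** * Densities, and measures on tuples *)

Section density.
Import HBNNSimple.

(** By monotone convergence along simple functions. This is what extends the
defining property of a conditional probability from events to nonnegative
functions. *)
Lemma ge0_integral_density (d : measure_display) (T : measurableType d)
    (R : realType) (mu nu : {measure set T -> \bar R}) (f g : T -> \bar R) :
  (forall x, 0 <= g x)%E -> (forall x, g x \is a fin_num) ->
  measurable_fun [set: T] g ->
  (forall A, measurable A -> nu A = \int[mu]_(x in A) g x)%E ->
  (forall x, 0 <= f x)%E -> measurable_fun [set: T] f ->
  (\int[nu]_x f x = \int[mu]_x (f x * g x))%E.
Proof.
move=> g0 gfin mg nuE f0 mf.
pose h := nnsfun_approx measurableT mf.
have hf x : ((h n x)%:E @[n --> \oo] --> f x)%E.
  exact: (cvg_nnsfun_approx measurableT mf).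
have hnd : {homo (fun n x => h n x) : a b / (a <= b)%N >-> forall x, a x <= b x}.
  by move=> a b ab x; exact/lefP/nd_nnsfun_approx.
have hE n : (\int[nu]_x (h n x)%:E = \int[mu]_x ((h n x)%:E * g x))%E.
  have mi r : measurable (h n @^-1` [set r]) by exact: measurable_funPTI.
  transitivity (\sum_(r \in range (h n)) r%:E * nu (h n @^-1` [set r]))%E.
    by rewrite integral_nnsfun// patch_setT sintegralE.
  transitivity (\int[mu]_x (\sum_(r \in range (h n))
      r%:E * ((\1_(h n @^-1` [set r]) x)%:E * g x)))%E; last first.
    apply: eq_integral => x _; rewrite [in RHS](fimfunE (h n)).
    rewrite -fsumEFin// ge0_mule_fsuml//; last first.
      by move=> r; rewrite lee_fin; exact: nnfun_muleindic_ge0.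
    by apply: eq_fsbigr => r _; rewrite EFinM muleA.
  have hr0 r x : (0 <= r%:E * ((\1_(h n @^-1` [set r]) x)%:E * g x))%E.
    by rewrite muleA mule_ge0// -EFinM; exact: nnfun_muleindic_ge0.
  have mig r : measurable_fun [set: T]
      (fun x => (\1_(h n @^-1` [set r]) x)%:E * g x)%E.
    by apply: emeasurable_funM => //; exact/measurable_EFinP.
  rewrite ge0_integral_fsum//; last first.
    by move=> r; exact: measurable_funeM.
  apply: eq_fsbigr => r /[!inE] -[x _ <-{r}].
  rewrite ge0_integralZl ?lee_fin//; last first.
    by move=> y _; rewrite mule_ge0// lee_fin.
  congr (_ * _)%E; rewrite nuE// integral_mkcond.
  apply: eq_integral => y _; rewrite patchE indicE.
  by case: ifPn; rewrite ?mul1e ?mul0e.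
have -> : (\int[nu]_x f x = limn (fun n => \int[nu]_x (h n x)%:E))%E.
  rewrite -monotone_convergence//.
  - by apply: eq_integral => x _; apply/esym/cvg_lim => //; exact: hf.
  - by move=> n; exact/measurable_EFinP.
  - by move=> n x _; rewrite lee_fin.
  - by move=> x _ a b ab; rewrite lee_fin hnd.
have -> : (\int[mu]_x (f x * g x) =
           limn (fun n => \int[mu]_x ((h n x)%:E * g x)))%E.
  rewrite -monotone_convergence//.
  - apply: eq_integral => x _; apply/esym/cvg_lim => //.
    by apply: cvgeZr => //; exact: hf.
  - by move=> n; apply: emeasurable_funM => //; exact/measurable_EFinP.
  - by move=> n x _; rewrite mule_ge0// lee_fin.
  - by move=> x _ a b ab; rewrite lee_wpmul2r// lee_fin hnd.
by congr (limn _); apply/funext.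
Qed.

End density.

Definition box (m : nat) (T : Type) (C : 'I_m -> set T) : set (m.-tuple T) :=
  [set t | forall i, C i (tnth t i)].

Lemma measurable_box (d : measure_display) (T : measurableType d) (m : nat)
    (C : 'I_m -> set T) :
  (forall i, measurable (C i)) -> measurable (box C).
Proof.
move=> mC; have -> : box C = \bigcap_(i in [set: 'I_m]) ((@tnth _ T)^~ i @^-1` C i).
  by apply/seteqP; split => [t tC i _|t tC i]; exact: tC.
apply: fin_bigcap_measurable => // i _.
by rewrite -[X in measurable X]setTI; exact: measurable_tnth.
Qed.

Lemma tuple_measure_unique (d : measure_display) (T : measurableType d)
    (R : realType) (G : set (set T)) (m : nat)
    (mu nu : {measure set (m.-tuple T) -> \bar R}) :
  measurable = <<s G >> -> setI_closed G -> G setT ->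
  (mu setT < +oo)%E ->
  (forall C : 'I_m -> set T, (forall i, G (C i)) -> mu (box C) = nu (box C)) ->
  forall A, measurable A -> mu A = nu A.
Proof.
move=> mG GI GT mufin munu.
have Gm A : G A -> measurable A by rewrite mG; exact: sub_sigma_algebra.
pose H := [set B | exists2 C : 'I_m -> set T, (forall i, G (C i)) & B = box C].
have HT : H setT by exists (fun=> setT) => //; apply/seteqP; split.
apply: (measure_unique H (fun=> setT)) => //.
- apply/seteqP; split; last first.
    apply: smallest_sub; first exact: sigma_algebra_measurable.
    by move=> _ [C GC ->]; apply: measurable_box => i; exact: Gm.
  (* the identity is measurable from the sigma-algebra generated by boxes, *)
  (* because each coordinate is: a constraint on one coordinate is a box *)
  have mid : @measurable_fun _ _ (g_sigma_algebraType H) (m.-tuple T) setT id.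
    apply/measurable_fun_tnthP => i; apply: (measurability G mG).
    move=> _ [A GA <-]; rewrite setTI; apply: sub_sigma_algebra.
    exists (fun j => if j == i then A else setT) => [j|].
      by case: ifP.
    apply/seteqP; split => [t /= Ati j|t /(_ i)/=]; last by rewrite eqxx.
    by case: eqP => [->|].
  by move=> A mA; have := mid measurableT A mA; rewrite setTI.
- move=> _ _ [C GC ->] [D GD ->].
  exists (fun i => C i `&` D i) => [i|]; first exact: GI.
  apply/seteqP; split => [t [tC tD] i|t tCD]; first by split; [exact: tC|exact: tD].
  by split => i; have [] := tCD i.
- by apply/seteqP; split => // t _; exists 0%N.
- by move=> _ [C GC ->]; exact: munu.
Qed.

Lemma emeasurable_prod (d : measure_display) (T : measurableType d)
    (R : realType) (I : Type) (s : seq I) (h : I -> T -> \bar R) :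
  (forall i, measurable_fun [set: T] (h i)) ->
  measurable_fun [set: T] (fun x => \big[*%E/1%E]_(i <- s) h i x).
Proof.
move=> mh; elim: s => [|i s IHs].
  by under eq_fun do rewrite big_nil; exact: measurable_cst.
by under eq_fun do rewrite big_cons; exact: emeasurable_funM.
Qed.

Lemma measurable_eval (d : measure_display) (T : measurableType d)
    (R : realType) (B : set T) : measurable B ->
  measurable_fun [set: pprobability T R]
    (fun q : pprobability T R => (q : probability T R) B).
Proof.
move=> mB.
exact: (measurable_kernel (kprobability (@measurable_id _ _ setT)) B mB).
Qed.

Lemma tuple_pair_measure_unique (d d' : measure_display)
    (T : measurableType d) (T' : measurableType d') (R : realType) (m : nat)
    (mu nu : {measure set (m.-tuple (T * T')) -> \bar R}) :
  (mu setT < +oo)%E ->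
  (forall (A : 'I_m -> set T) (B : 'I_m -> set T'),
    (forall i, measurable (A i)) -> (forall i, measurable (B i)) ->
    mu (box (fun i => A i `*` B i)) = nu (box (fun i => A i `*` B i))) ->
  forall S, measurable S -> mu S = nu S.
Proof.
move=> mufin munu.
apply: (tuple_measure_unique (measurable_prod_measurableType T T')) => //.
- move=> _ _ [A1 mA1 [B1 mB1 <-]] [A2 mA2 [B2 mB2 <-]].
  exists (A1 `&` A2); first exact: measurableI.
  by exists (B1 `&` B2); [exact: measurableI|rewrite setXI].
- by exists setT => //; exists setT => //; rewrite setXTT.
- move=> C GC.
  have /choice[A hA] : forall i, exists A, measurable A /\
      exists2 B, measurable B & A `*` B = C i.
    by move=> i; have [A mA AC] := GC i; exists A.
  have /choice[B hB] : forall i, exists B, measurable B /\ A i `*` B = C i.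
    by move=> i; have [_ [B mB BC]] := hA i; exists B.
  have -> : C = (fun i => A i `*` B i).
    by apply/funext => i; have [] := hB i.
  by apply: munu => i; [have [] := hA i|have [] := hB i].
Qed.

(** * The law of the sample given the latent pairs *)

Section latent_model.
Context (R : realType) (dO dX dY : measure_display)
  (Omega : measurableType dO) (P : probability Omega R)
  (TX : measurableType dX) (TY : measurableType dY) (m : nat)
  (X : 'I_m -> Omega -> TX) (Q : 'I_m -> Omega -> pprobability TY R)
  (Y : 'I_m -> Omega -> TY).
Hypothesis mX : forall i, measurable_fun [set: Omega] (X i).
Hypothesis mQ : forall i, measurable_fun [set: Omega] (Q i).
Hypothesis mY : forall i, measurable_fun [set: Omega] (Y i).

Let L omega := [tuple latent X Q i omega | i < m].
Let outcomes_in (B : 'I_m -> set TY) := [set omega | forall i, B i (Y i omega)].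

Let measurable_tuple_eval (i : 'I_m) (B : set TY) : measurable B ->
  measurable_fun [set: m.-tuple (TX * pprobability TY R)]
    (fun t => ((tnth t i).2 : probability TY R) B).
Proof.
move=> mB.
apply: (@measurableT_comp _ _ _ _ _ _
  (fun q : pprobability TY R => (q : probability TY R) B)).
  exact: measurable_eval.
by apply: measurableT_comp => //; exact: measurable_tnth.
Qed.

Lemma measurable_latent : measurable_fun [set: Omega] L.
Proof.
apply/measurable_fun_tnthP => i.
rewrite (_ : _ \o _ = latent X Q i); last first.
  by apply/funext => omega /=; rewrite tnth_mktuple.
by apply/measurable_fun_pairP; split; [exact: mX|exact: mQ].
Qed.

Lemma measurable_outcomes_in (B : 'I_m -> set TY) :
  (forall i, measurable (B i)) -> measurable (outcomes_in B).
Proof.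
move=> mB; have -> : outcomes_in B = \bigcap_(i in [set: 'I_m]) (Y i @^-1` B i).
  by apply/seteqP; split => [w wB i _|w wB i]; exact: wB.
apply: fin_bigcap_measurable => // i _.
by rewrite -[X in measurable X]setTI; exact: mY.
Qed.

Hypothesis hindep : outcomes_cond_indep P X Q Y.

(** Conditional independence, integrated against a function of the latent pairs.
The indicator of the outcome event is a density of the restriction of [P] to
this event; pushed forward by the latent pairs, the restriction has the product
of conditional probabilities as its density. *)
Lemma integral_outcomes_in (B : 'I_m -> set TY)
    (f : m.-tuple (TX * pprobability TY R) -> \bar R) :
  (forall i, measurable (B i)) ->
  (forall t, 0 <= f t)%E -> measurable_fun [set: m.-tuple (TX * pprobability TY R)] f ->
  (\int[P]_omega (f (L omega) * (\1_(outcomes_in B) omega)%:E) =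
   \int[P]_omega (f (L omega) *
      \big[*%E/1%E]_(i < m) (Q i omega : probability TY R) (B i)))%E.
Proof.
move=> mB f0 mf.
have mE := measurable_outcomes_in mB; have mL := measurable_latent.
pose g (t : m.-tuple (TX * pprobability TY R)) :=
  (\big[*%E/1%E]_(i < m) ((tnth t i).2 : probability TY R) (B i))%E.
have [mg gE] : is_cond_prob P L (outcomes_in B) g := hindep mB.
have g0 t : (0 <= g t)%E by apply: prode_ge0.
have gfin t : g t \is a fin_num.
  apply: (@big_ind _ (fun x : \bar R => x \is a fin_num)) => // [x y|i _].
    exact: fin_numM.
  exact: fin_num_measure.
transitivity (\int[mrestr P mE]_omega (f (L omega)))%E.
  apply/esym/ge0_integral_density => //.
  - exact/measurable_EFinP.
  - by move=> A mA; rewrite integral_indic// setIC.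
  - exact: measurableT_comp.
transitivity (\int[pushforward (mrestr P mE) L]_t f t)%E.
  by rewrite ge0_integral_pushforward.
rewrite (@ge0_integral_density _ _ _ (pushforward P L) _ f g)//.
- rewrite ge0_integral_pushforward//=.
  + apply: eq_integral => w _; congr (_ * _)%E.
    by apply: eq_bigr => i _; rewrite tnth_mktuple.
  + exact: emeasurable_funM.
  + by move=> t _; rewrite mule_ge0.
- move=> A mA; rewrite ge0_integral_pushforward//.
  + by rewrite -gE.
  + exact: measurable_funTS.
Qed.

Let sample omega := [tuple (X i omega, Y i omega) | i < m].

Lemma measurable_pair_tuple (d : measure_display) (T : measurableType d)
    (x : 'I_m -> T -> TX) (y : 'I_m -> T -> TY) :
  (forall i, measurable_fun [set: T] (x i)) ->
  (forall i, measurable_fun [set: T] (y i)) ->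
  measurable_fun [set: T] (fun w => [tuple (x i w, y i w) | i < m]).
Proof.
move=> mx my; apply/measurable_fun_tnthP => i.
rewrite (_ : _ \o _ = fun w => (x i w, y i w)); last first.
  by apply/funext => w /=; rewrite tnth_mktuple.
by apply/measurable_fun_pairP; split; [exact: mx|exact: my].
Qed.

Let box_fst (A : 'I_m -> set TX) : set (m.-tuple (TX * pprobability TY R)) :=
  box (fun i => A i `*` setT).

Let measurable_box_fst (A : 'I_m -> set TX) :
  (forall i, measurable (A i)) -> measurable (box_fst A).
Proof. by move=> mA; apply: measurable_box => i; exact: measurableX. Qed.

Lemma prob_sample_box (A : 'I_m -> set TX) (B : 'I_m -> set TY) :
  (forall i, measurable (A i)) -> (forall i, measurable (B i)) ->
  (P (sample @^-1` box (fun i => A i `*` B i)) =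
   \int[P]_omega ((\1_(box_fst A) (L omega))%:E *
      \big[*%E/1%E]_(i < m) (Q i omega : probability TY R) (B i)))%E.
Proof.
move=> mA mB; have mbA := measurable_box_fst mA.
rewrite -(@integral_outcomes_in B (fun t => (\1_(box_fst A) t)%:E))//; last first.
  exact/measurable_EFinP.
have mL := measurable_latent.
have mS : measurable (sample @^-1` box (fun i => A i `*` B i)).
  rewrite -[X in measurable X]setTI.
  apply: (measurable_pair_tuple mX mY) => //.
  by apply: measurable_box => i; exact: measurableX.
rewrite -[X in P X]setIT -integral_indic//; apply: eq_integral => w _.
rewrite -EFinM !indicE -natrM mulnb; congr (_%:R%:E); congr nat_of_bool.
apply/idP/andP => [/[!inE] wAB|[/[!inE] wA wB]].
  by split => i; have := wAB i; rewrite !tnth_mktuple => -[].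
by move=> i; have := wA i; rewrite !tnth_mktuple => -[? _]; split => //; exact: wB.
Qed.

(** Permuting the sample over a box amounts to permuting the latent pairs inside
the integral of [prob_sample_box], and the law of the latent pairs is invariant.
*)
Lemma exchangeable_sample : exchangeable P (latent X Q) ->
  exchangeable P (fun i omega => (X i omega, Y i omega)).
Proof.
move=> hexch sigma S mS.
pose sample_perm omega := [tuple (X (sigma i) omega, Y (sigma i) omega) | i < m].
have msp : measurable_fun [set: Omega] sample_perm.
  by apply: measurable_pair_tuple => i; [exact: mX|exact: mY].
have ms : measurable_fun [set: Omega] sample by exact: measurable_pair_tuple.
apply: (@tuple_pair_measure_unique _ _ _ _ _ _ (pushforward P sample_perm)
  (pushforward P sample) _ _ S mS) => /=.
  by rewrite /pushforward preimage_setT probability_setT ltry.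
move=> A B mA mB; rewrite /pushforward.
pose A' i := A ((sigma^-1)%g i); pose B' i := B ((sigma^-1)%g i).
have -> : sample_perm @^-1` box (fun i => A i `*` B i) =
          sample @^-1` box (fun i => A' i `*` B' i).
  apply/seteqP; split => w wAB i.
    have := wAB ((sigma^-1)%g i).
    by rewrite !tnth_mktuple permKV.
  by have := wAB (sigma i); rewrite /A' /B' !tnth_mktuple permK.
rewrite !prob_sample_box//; [|by move=> i; exact: mA|by move=> i; exact: mB].
pose h (t : m.-tuple (TX * pprobability TY R)) := ((\1_(box_fst A) t)%:E *
  \big[*%E/1%E]_(i < m) ((tnth t i).2 : probability TY R) (B i))%E.
have mh : measurable_fun [set: m.-tuple (TX * pprobability TY R)] h.
  apply: emeasurable_funM.
    by apply/measurable_EFinP/measurable_indic; exact: measurable_box_fst.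
  apply: emeasurable_prod => i; exact: measurable_tuple_eval.
have h0 t : (0 <= h t)%E.
  by rewrite mule_ge0 ?lee_fin//; apply: prode_ge0.
pose L_perm omega := [tuple latent X Q (sigma i) omega | i < m].
have mL := measurable_latent.
have mLp : measurable_fun [set: Omega] L_perm.
  apply/measurable_fun_tnthP => i.
  rewrite (_ : _ \o _ = (@tnth _ _)^~ (sigma i) \o L); last first.
    by apply/funext => w /=; rewrite !tnth_mktuple.
  by apply: measurableT_comp => //; exact: measurable_tnth.
transitivity (\int[P]_omega h (L_perm omega))%E.
  apply: eq_integral => w _; rewrite /h; congr (_%:E * _)%E.
    rewrite !indicE; congr (_%:R); congr nat_of_bool.
    apply/idP/idP => /[!inE] wA i.
      by have := wA (sigma i); rewrite /A' permK !tnth_mktuple.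
    by have := wA ((sigma^-1)%g i); rewrite !tnth_mktuple permKV.
  rewrite (reindex_inj (@perm_inj _ sigma)); apply: eq_bigr => i _.
  by rewrite /B' permK tnth_mktuple.
transitivity (\int[P]_omega h (L omega))%E; last first.
  apply: eq_integral => w _; rewrite /h; congr (_ * _)%E.
  by apply: eq_bigr => i _; rewrite tnth_mktuple.
transitivity (\int[pushforward P L_perm]_t h t)%E.
  by rewrite ge0_integral_pushforward.
transitivity (\int[pushforward P L]_t h t)%E; last first.
  by rewrite ge0_integral_pushforward.
by apply: eq_measure_integral => C mC _; exact: hexch.
Qed.

(** Redrawing one outcome from its conditional law leaves the law of the sample
unchanged. As a function of [S], the right-hand side is the image of the measure
[P (domega) Q j omega (dy)] under the redrawing map, hence a finite measure
determined by its values on boxes of rectangles [A i `*` B i]; there, the factor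
[Q j omega (B j)] takes the place of the event on [Y j]. *)
Lemma prob_sample_resample (j : 'I_m) (S : set (m.-tuple (TX * TY))) :
  measurable S ->
  (P (sample @^-1` S) = \int[P]_omega (Q j omega : probability TY R)
     [set y | S [tuple (X i omega, if i == j then y else Y i omega) | i < m]])%E.
Proof.
move=> mS.
pose resample (p : Omega * TY) :=
  [tuple (X i p.1, if i == j then p.2 else Y i p.1) | i < m].
have mr : measurable_fun [set: Omega * TY] resample.
  apply: measurable_pair_tuple => i; first exact: measurableT_comp.
  by case: (i == j) => //; exact: measurableT_comp.
have ms : measurable_fun [set: Omega] sample by exact: measurable_pair_tuple.
(* a kernel with trivial source serves as the measure P *)
pose kP := kprobability (@measurable_cst _ _ unit _ setT (P : pprobability Omega R)).
pose kQ := kprobability (measurableT_comp (mQ j) (@measurable_snd _ _ unit Omega)).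
have kE C : measurable C ->
    (kproduct kP kQ tt (resample @^-1` C) = \int[P]_omega
      (Q j omega : probability TY R) [set y | C (resample (omega, y))])%E.
  move=> mC; apply: eq_integral => w _.
  have mrC : measurable (resample @^-1` C).
    by rewrite -[X in measurable X]setTI; exact: mr.
  have := measurable_xsection w mrC; rewrite xsectionE => mx.
  have := @integral_indic _ _ R (Q j w : probability TY R) _ measurableT _ mx.
  by rewrite setIT.
rewrite -[RHS](kE _ mS).
apply: (@tuple_pair_measure_unique _ _ _ _ _ _ (pushforward P sample)
  (pushforward (kproduct kP kQ tt) resample) _ _ S mS) => /=.
  by rewrite /pushforward preimage_setT probability_setT ltry.
move=> A B mA mB; rewrite /pushforward.
rewrite kE; last by apply: measurable_box => i; exact: measurableX.
rewrite prob_sample_box//.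
(* drops the constraint on the original outcome Y j *)
pose B' i := if i == j then setT else B i.
have mB' i : measurable (B' i) by rewrite /B'; case: ifP.
pose f (t : m.-tuple (TX * pprobability TY R)) :=
  ((\1_(box_fst A) t)%:E * ((tnth t j).2 : probability TY R) (B j))%E.
transitivity (\int[P]_omega (f (L omega) *
    \big[*%E/1%E]_(i < m) (Q i omega : probability TY R) (B' i)))%E.
  apply: eq_integral => w _; rewrite /f -muleA; congr (_ * _)%E.
  rewrite (bigD1 j)//= [in RHS](bigD1 j)//= tnth_mktuple /B' eqxx.
  rewrite probability_setT mul1e; congr (_ * _)%E.
  by apply: eq_bigr => i /negbTE ->.
rewrite -integral_outcomes_in//; last 2 first.
  by move=> t; rewrite /f mule_ge0// lee_fin.
  apply: emeasurable_funM.
    by apply/measurable_EFinP/measurable_indic; exact: measurable_box_fst.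
  exact: measurable_tuple_eval.
apply: eq_integral => w _; rewrite /f tnth_mktuple /=.
rewrite muleAC -EFinM !indicE -natrM mulnb.
case: (boolP (_ && _)) => [/andP[/[!inE] wA wB]|wAB].
  rewrite mul1e; congr (Q j w _); apply/seteqP; split => [y Bjy i|y /(_ j)].
    rewrite tnth_mktuple; split => /=.
      by have := wA i; rewrite tnth_mktuple => -[].
    by case: eqP => [->//|/eqP/negbTE ij]; have := wB i; rewrite /B' ij.
  by rewrite tnth_mktuple/= eqxx => -[].
rewrite mul0e [X in (Q j w : probability TY R) X](_ : _ = set0) ?measure0//.
apply/seteqP; split => // y /= wy; move/negP: wAB; apply.
apply/andP; split; rewrite inE => i.
  by have := wy i; rewrite !tnth_mktuple => -[].
by have := wy i; rewrite tnth_mktuple /B'/=; case: eqP => // _ [].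
Qed.

End latent_model.

(** * Ranks of exchangeable scores *)

Section exceeds_probability.
Context (R : realType) (d : measure_display) (T : measurableType d) (m : nat)
  (r : T -> R).
Hypothesis mr : measurable_fun [set: T] r.

Lemma measurable_exceeds (k : nat) (j : 'I_m) :
  measurable [set t : m.-tuple T | exceeds k (fun i => r (tnth t i)) j].
Proof.
pose below i := [set t : m.-tuple T | r (tnth t i) < r (tnth t j)].
have mrt i : measurable_fun [set: m.-tuple T] (fun t => r (tnth t i)).
  by apply: measurableT_comp => //; exact: measurable_tnth.
have mb i : measurable (below i).
  rewrite -[X in measurable X]setTI.
  exact: (measurable_fun_ltr (mrt i) (mrt j) measurableT (Y := [set true])).
rewrite (_ : [set t | _] = setT `&` [set t | k%:R <= \sum_(i < m) (\1_(below i) t : R)]).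
  apply: measurable_fun_le => //.
  by apply: measurable_sum => i; exact: measurable_indic.
rewrite setTI; apply/funext => t; apply/propext.
rewrite /= /exceeds -sum1_card big_mkcond/= -(ler_nat R) natr_sum.
rewrite (eq_bigr (fun i => \1_(below i) t))// => i _.
rewrite inE indicE; case: ifPn => [lt_ij|/negP nlt_ij].
  by rewrite mem_set.
by rewrite memNset.
Qed.

(** The [m] events indexed by [j] have the same probability, and their indicators
add up to at most [m - k] everywhere. *)
Lemma exchangeable_prob_exceeds (dO : measure_display)
    (Omega : measurableType dO) (P : probability Omega R)
    (W : 'I_m -> Omega -> T) (k : nat) (j : 'I_m) :
  (forall i, measurable_fun [set: Omega] (W i)) -> exchangeable P W ->
  (m%:R%:E * P [set omega | exceeds k (fun i => r (W i omega)) j] <=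
   (m - k)%:R%:E)%E.
Proof.
move=> mW hexch.
pose bad j := [set omega | exceeds k (fun i => r (W i omega)) j].
have badE j' : bad j' = (fun omega => [tuple W i omega | i < m]) @^-1`
    [set t | exceeds k (fun i => r (tnth t i)) j'].
  apply/funext => w; rewrite /bad/=; congr (is_true (exceeds k _ j')).
  by apply/funext => i; rewrite tnth_mktuple.
have mWt : measurable_fun [set: Omega] (fun omega => [tuple W i omega | i < m]).
  apply/measurable_fun_tnthP => i.
  rewrite (_ : _ \o _ = W i)//.
  by apply/funext => w /=; rewrite tnth_mktuple.
have mbad j' : measurable (bad j').
  rewrite badE -[X in measurable X]setTI; apply: mWt => //.
  exact: measurable_exceeds.
have badP j' : P (bad j') = P (bad j).
  rewrite [in RHS]badE -(hexch (tperm j j') _ (measurable_exceeds k j)).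
  congr (P _); apply/funext => w; rewrite /bad/=.
  rewrite -[in LHS](tpermL j j') -(exceeds_perm k (fun i => r (W i w))).
  congr (is_true (exceeds k _ j)).
  by apply/funext => i; rewrite tnth_mktuple.
rewrite -/(bad j).
have -> : (m%:R%:E * P (bad j) = \sum_(j' < m) P (bad j'))%E.
  under eq_bigr do rewrite badP.
  by rewrite sumr_const card_ord mule_natl.
under eq_bigr => j' _ do rewrite -[X in P X]setIT -integral_indic//.
rewrite -ge0_integral_sum//; last by move=> j'; exact/measurable_EFinP.
rewrite -[leRHS]mule1 -(probability_setT P) -integral_cst//.
apply: ge0_le_integral => //.
- by move=> w _; rewrite sume_ge0// => i _; rewrite lee_fin.
- by apply: emeasurable_sum => i; exact/measurable_EFinP.
- move=> w _; rewrite sumEFin lee_fin/=.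
  pose J := [set j | exceeds k (fun i => r (W i w)) j]%SET.
  rewrite (eq_bigr (fun j' => (j' \in J)%:R)); last first.
    by move=> j' _; rewrite indicE inE mem_setE.
  rewrite -natr_sum ler_nat -big_mkcond/= sum1_card.
  exact: card_exceeds.
Qed.

End exceeds_probability.

(** * Expected miscoverage of a conformal set *)

Section miscoverage.
Context (R : realType) (dO dX dY : measure_display)
  (Omega : measurableType dO) (P : probability Omega R)
  (TX : measurableType dX) (TY : measurableType dY) (n : nat)
  (X : 'I_n.+1 -> Omega -> TX) (Q : 'I_n.+1 -> Omega -> pprobability TY R)
  (Y : 'I_n.+1 -> Omega -> TY) (s : TX -> TY -> R) (gamma : R).
Hypothesis mX : forall i, measurable_fun [set: Omega] (X i).
Hypothesis mQ : forall i, measurable_fun [set: Omega] (Q i).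
Hypothesis mY : forall i, measurable_fun [set: Omega] (Y i).
Hypothesis ms : measurable_fun [set: TX * TY] (fun p => s p.1 p.2).
Hypothesis gamma01 : 0 < gamma < 1.

Let score (p : TX * TY) := s p.1 p.2.
Let k := conformal_rank n gamma.

Let resample (p : Omega * TY) :=
  [tuple (X i p.1, if i == ord_max then p.2 else Y i p.1) | i < n.+1].

Let missed := [set p : Omega * TY |
  exceeds k (fun i => score (tnth (resample p) i)) ord_max].

Let conformal_region omega :=
  conformal_set s (calibration X Y omega) gamma (X ord_max omega).

Let measurable_missed : measurable missed.
Proof.
rewrite -[X in measurable X]setTI.
have mr : measurable_fun [set: Omega * TY] resample.
  apply: measurable_pair_tuple => i; first exact: measurableT_comp.
  by case: (i == ord_max) => //; exact: measurableT_comp.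
exact: (mr measurableT _ (measurable_exceeds ms k ord_max)).
Qed.

Let setC_conformal_region omega :
  ~` conformal_region omega = xsection missed omega.
Proof.
rewrite xsectionE; apply/funext => y; apply/propext.
apply: (@conformal_setPn _ _ _ n s (resample (omega, y))) => // [i|].
  by rewrite !tnth_mktuple/= -(inj_eq val_inj)/= ltn_eqF.
by rewrite tnth_mktuple eqxx.
Qed.

Lemma measurable_conformal_region omega : measurable (conformal_region omega).
Proof.
rewrite -[X in measurable X]setCK setC_conformal_region.
by apply: measurableC; exact: measurable_xsection.
Qed.

Let missE omega : (1 - (Q ord_max omega : probability TY R)
   (conformal_region omega) = (Q ord_max omega : probability TY R)
   (xsection missed omega))%E.
Proof.
rewrite -setC_conformal_region probability_setC//.
exact: measurable_conformal_region.
Qed.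

Lemma measurable_miscoverage : measurable_fun [set: Omega]
  (fun omega => 1 - (Q ord_max omega : probability TY R) (conformal_region omega))%E.
Proof.
rewrite (_ : (fun _ => _) = fun omega =>
    kprobability (mQ ord_max) omega (xsection missed omega)); last first.
  by apply/funext => omega; exact: missE.
by apply: measurable_fun_xsection_finite_kernel; rewrite inE.
Qed.

Lemma integral_miscoverage_le :
  exchangeable P (latent X Q) -> outcomes_cond_indep P X Q Y ->
  (\int[P]_omega (1 - (Q ord_max omega : probability TY R)
     (conformal_region omega)) <= gamma%:E)%E.
Proof.
move=> hexch hindep.
under eq_integral do rewrite missE xsectionE.
rewrite -(prob_sample_resample mX mQ mY hindep ord_max (measurable_exceeds ms k ord_max)).
have mXY i : measurable_fun [set: Omega] (fun w => (X i w, Y i w)).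
  by apply/measurable_fun_pairP; split; [exact: mX|exact: mY].
have := exchangeable_prob_exceeds ms k ord_max mXY
  (exchangeable_sample mX mQ mY hindep hexch).
rewrite (_ : [set _ | _] = (fun w => [tuple (X i w, Y i w) | i < n.+1]) @^-1`
    [set t | exceeds k (fun i => score (tnth t i)) ord_max]); last first.
  apply/funext => w; rewrite /=; congr (is_true (exceeds k _ _)).
  by apply/funext => i; rewrite tnth_mktuple.
move=> bound; rewrite -(@lee_pmul2l _ n.+1%:R%:E)// ?lte_fin//.
apply: (le_trans bound); rewrite -EFinM lee_fin natrB ?conformal_rank_le//.
rewrite lerBlDl -lerBlDr -[X in X - _]mulr1 -mulrBr.
exact: conformal_rank_ge.
Qed.

End miscoverage.

(** * Measurable integrals and Markov's inequality *)

Lemma measurable_integral_kernel (d d' : measure_display)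
    (T : measurableType d) (T' : measurableType d') (R : realType)
    (kappa : R.-fker T ~> T') (f : T * T' -> \bar R) :
  measurable_fun [set: T * T'] f ->
  measurable_fun [set: T] (fun x => \int[kappa x]_y f (x, y))%E.
Proof.
move=> mf.
rewrite (_ : (fun _ => _) = fun x =>
    (\int[kappa x]_y f^\+ (x, y) - \int[kappa x]_y f^\- (x, y))%E); last first.
  by apply/funext => x; rewrite integralE; congr (_ - _)%E;
    apply: eq_integral => y _; rewrite ?funeposE ?funenegE.
apply: emeasurable_funB.
- apply: (measurable_fun_integral_finite_kernel (f^\+)%E kappa) => //.
  exact: measurable_funepos.
- apply: (measurable_fun_integral_finite_kernel (f^\-)%E kappa) => //.
  exact: measurable_funeneg.
Qed.

Lemma markov_inv_level (d : measure_display) (T : measurableType d) (R : realType)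
    (P : probability T R) (f : T -> \bar R) (alpha : R) : 0 < alpha ->
  measurable_fun [set: T] f -> (forall x, 0 <= f x)%E ->
  (\int[P]_x f x <= 1)%E ->
  ((1 - alpha)%:E <= P [set x | (f x <= (alpha^-1)%:E)%E])%E.
Proof.
move=> a0 mf f0 If.
pose bad := [set x | (alpha^-1)%:E < f x]%E.
have mbad : measurable bad.
  rewrite -[X in measurable X]setTI; exact: measurable_lte.
have goodE : [set x | (f x <= (alpha^-1)%:E)%E] = ~` bad.
  by apply/funext => x; apply/propext; rewrite /bad/= leNgt; split => /negP.
rewrite goodE probability_setC// EFinB leeB//.
rewrite -(@lee_pmul2l _ (alpha^-1)%:E)// ?lte_fin ?invr_gt0//.
rewrite -[leRHS]EFinM mulVf ?gt_eqF//.
apply: le_trans If.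
have := @le_integral_comp_abse _ _ _ P _ measurableT f alpha^-1 id
  (@measurable_id _ _ _) (fun _ => id) (fun _ _ _ _ => id) mf.
rewrite invr_gt0 => /(_ a0); rewrite setTI.
under [leRHS]eq_integral do rewrite gee0_abs//.
apply: le_trans; apply: lee_wpmul2l; first by rewrite lee_fin invr_ge0 ltW.
apply: le_measure; rewrite ?inE//.
  rewrite -[X in measurable X]setTI; apply: measurable_lee => //.
  exact: measurableT_comp.
by move=> x /= /ltW; rewrite gee0_abs.
Qed.

(** * The risk guarantee *)

Theorem corollary1 (R : realType)
  (dO dX dY dZ : measure_display)
  (Omega : measurableType dO) (P : probability Omega R)
  (TX : measurableType dX) (TY : measurableType dY) (TZ : measurableType dZ)
  (hTX : standard_borel R TX) (hTY : standard_borel R TY)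
  (n : nat)
  (X : 'I_n.+1 -> Omega -> TX)
  (Q : 'I_n.+1 -> Omega -> pprobability TY R)
  (Y : 'I_n.+1 -> Omega -> TY)
  (mX : forall i, measurable_fun [set: Omega] (X i))
  (mQ : forall i, measurable_fun [set: Omega] (Q i))
  (mY : forall i, measurable_fun [set: Omega] (Y i))
  (pi_ : R.-pker TX ~> pprobability TY R)
  (hpi : forall i, has_cond_law P (Q i) (X i) pi_)
  (hexch : exchangeable P (latent X Q))
  (hindep : outcomes_cond_indep P X Q Y)
  (s : TX -> TY -> R)
  (ms : measurable_fun [set: TX * TY] (fun p => s p.1 p.2))
  (alpha : R) (halpha : 0 < alpha < 1)
  (Gamma : set R) (hGamma : Gamma `<=` `]0, alpha[)
  (K : nat) (hK : (1 <= K)%N) (w gamma : 'I_K -> R)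
  (hgamma : forall k, Gamma (gamma k))
  (hw0 : forall k, 0 <= w k) (hw1 : \sum_(k < K) w k = 1)
  (feasible : TX -> set TZ)
  (c : TZ -> TY -> R)
  (mc : measurable_fun [set: TZ * TY] (fun p => c p.1 p.2))
  (U := ambiguity_set s alpha w gamma :
     n.-tuple (TX * TY) -> TX -> set (probability TY R))
  (D := calibration X Y : Omega -> n.-tuple (TX * TY))
  (Xnew := X ord_max : Omega -> TX)
  (Qnew := Q ord_max : Omega -> probability TY R)
  (hU : forall omega x, U (D omega) x !=set0)
  (zhat : n.-tuple (TX * TY) -> TX -> TZ)
  (Vhat := (fun (data : n.-tuple (TX * TY)) (x : TX) =>
     robust_risk (U data x) (c (zhat data x))) :
     n.-tuple (TX * TY) -> TX -> \bar R)
  (hzhat : forall omega x,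
     argmin_set (feasible x) (fun z => robust_risk (U (D omega) x) (c z))
       (zhat (D omega) x))
  (mzhat : measurable_fun [set: Omega]
     (fun omega => zhat (D omega) (Xnew omega)))
  (mVhat : measurable_fun [set: Omega]
     (fun omega => Vhat (D omega) (Xnew omega)))
  (hint_risk : forall omega x z, feasible x z ->
     forall Q0, U (D omega) x Q0 -> integral_defined Q0 (c z))
  (hint_new : {ae P, forall omega,
     integral_defined (Qnew omega) (c (zhat (D omega) (Xnew omega)))}) :
  ((1 - alpha)%:E <=
     P [set omega |
          \int[Qnew omega]_y (c (zhat (D omega) (Xnew omega)) y)%:E
            <= Vhat (D omega) (Xnew omega)])%E.
Proof.
have [a0 a1] := andP halpha.
have gamma_itv k : 0 < gamma k < alpha.
  by have := hGamma _ (hgamma k); rewrite /= in_itv.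
have gamma01 k : 0 < gamma k < 1.
  by have /andP[g0 ga] := gamma_itv k; rewrite g0 (lt_trans ga).
pose miss k omega :=
  (1 - Qnew omega (conformal_set s (D omega) (gamma k) (Xnew omega)))%E.
have mmiss k : measurable_fun [set: Omega] (miss k).
  exact: measurable_miscoverage.
have miss0 k omega : (0 <= miss k omega)%E.
  rewrite /miss sube_ge0; last first.
    by rewrite fin_num_measure//; exact: measurable_conformal_region.
  by apply: probability_le1; exact: measurable_conformal_region.
have wg0 k : 0 <= w k / gamma k.
  by rewrite divr_ge0//; have /andP[/ltW] := gamma_itv k.
pose M omega := (\sum_(k < K) (w k / gamma k)%:E * miss k omega)%E.
have mM : measurable_fun [set: Omega] M.
  by apply: emeasurable_sum => k; exact: measurable_funeM.
have M0 omega : (0 <= M omega)%E.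
  by apply: sume_ge0 => k _; rewrite mule_ge0// lee_fin.
have IM : (\int[P]_omega M omega <= 1)%E.
  rewrite ge0_integral_sum//; last 2 first.
  - by move=> k; exact: measurable_funeM.
  - by move=> k omega _; rewrite mule_ge0// lee_fin.
  (* each atom contributes at most w k / gamma k * gamma k = w k *)
  rewrite -hw1 -sumEFin; apply: lee_sum => k _.
  rewrite ge0_integralZl//; last by rewrite lee_fin.
  have /andP[g0 _] := gamma_itv k.
  rewrite -[leRHS](_ : (w k / gamma k)%:E * (gamma k)%:E = _)%E; last first.
    by rewrite -EFinM divfK// gt_eqF.
  by apply: lee_wpmul2l; [rewrite lee_fin|exact: integral_miscoverage_le].
apply: (le_trans (markov_inv_level a0 mM M0 IM)).
(* both events have to be measurable for their probabilities to be comparable *)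
have mloss : measurable_fun [set: Omega] (fun omega =>
    \int[Qnew omega]_y (c (zhat (D omega) (Xnew omega)) y)%:E)%E.
  apply: (measurable_integral_kernel (kprobability (mQ ord_max))
    (f := fun p => (c (zhat (D p.1) (Xnew p.1)) p.2)%:E)).
  apply/measurable_EFinP.
  rewrite [X in measurable_fun _ X](_ : _ = (fun p : TZ * TY => c p.1 p.2) \o
    (fun p : Omega * TY => (zhat (D p.1) (Xnew p.1), p.2)))//.
  apply: (measurableT_comp mc).
  apply/measurable_fun_pairP; split; last exact: measurable_snd.
  exact: (measurableT_comp mzhat measurable_fst).
have mU : measurable [set omega | (M omega <= (alpha^-1)%:E)%E].
  by rewrite -[X in measurable X]setTI; exact: measurable_lee.
have mV : measurable [set omega |
    (\int[Qnew omega]_y (c (zhat (D omega) (Xnew omega)) y)%:E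
      <= Vhat (D omega) (Xnew omega))%E].
  by rewrite -[X in measurable X]setTI; exact: measurable_lee.
apply: (le_measure P (mem_set mU) (mem_set mV)) => omega QU.
by apply: ereal_sup_ubound; exists (Qnew omega).
Qed.
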